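(* For $k \ge 1$ let $p_k$ denote the $k$-th prime. Then $\tilde{\varphi}(p_k) = p_k - k$ for every $k\ge 1$. In general, for every positive integer $n$, $\tilde{\varphi}(n) = \varphi(n) - \pi(n) + \omega(n)$.
   Context: $\mathbb{N}$ denotes the set of positive integers. For $n \in \mathbb{N}$, let $E_n = \{m \in \mathbb{N} : 1 \le m \le n,\ \gcd(m,n)=1,\ m \text{ is not a prime}\}$ and $\tilde{\varphi}(n) = |E_n|$ (note that $1$ is not a prime). Here $\varphi(n) = |\{k : 1\le k\le n,\ \gcd(k,n)=1\}|$ is the Euler totient function, $\pi(n)$ is the number of primes less than or equal to $n$, and $\omega(n)$ is the number of distinct prime divisors of $n$. *)

(* Defs.v *)
From mathcomp Require Import all_boot.

Set Implicit Arguments.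
Unset Strict Implicit.
Unset Printing Implicit Defensive.

Lemma ex_prime_above (m : nat) : exists p, (m < p) && prime p.
Proof. by have [p lt_mp p_pr] := prime_above m; exists p; rewrite lt_mp. Qed.

Definition next_prime (m : nat) : nat := ex_minn (ex_prime_above m).

(* The primes are numbered from 1: kth_prime 1 = 2, kth_prime 2 = 3, etc.; the  *)
(* value kth_prime 0 = 1 is only the seed of the iteration.                     *)
Definition kth_prime (k : nat) : nat := iter k next_prime 1.

Definition coprime_nonprimes (n : nat) : {set 'I_n.+1} :=
  [set m : 'I_n.+1 | [&& 1 <= m, coprime m n & ~~ prime m]].

Definition totient_np (n : nat) : nat := #|coprime_nonprimes n|.

Definition prime_pi (n : nat) : nat := #|[set p : 'I_n.+1 | prime p]|.

Definition prime_omega (n : nat) : nat := size (primes n).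

(* Main.v *)
Require Import Defs.
From mathcomp Require Import all_boot all_order all_algebra.
From mathcomp Require Import zify.

(** Let [A] be the set of integers of [1, n] coprime to [n] and [P] the set of
    primes up to [n].  The set counted by the modified totient is [A :\: P], so
    the formula follows from [#|A| - #|A :&: P| = #|A| - (#|P| - #|P :\: A|)]:
    [#|A|] is the Euler totient ([card_coprime_pos]), and since a prime fails to
    be coprime to [n] exactly when it divides [n], the set [P :\: A] consists of
    the prime divisors of [n] ([card_prime_divisors]).

    For a prime [p] the totient is [p - 1] and [p] has one prime divisor, so the
    formula reduces to [p - prime_pi p]; the count of primes up to the [k]-th
    prime is [k], because exactly one prime exceeds [m] without exceeding
    [next_prime m] ([prime_pi_next]). *)

Local Open Scope nat_scope.

Definition coprime_pos (n : nat) : {set 'I_n.+1} :=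
  [set m : 'I_n.+1 | (0 < m) && coprime m n].

Definition primes_upto (n : nat) : {set 'I_n.+1} := [set p : 'I_n.+1 | prime p].

(** [totient n] counts over [0, n) whereas [coprime_pos] lives in [1, n];
    the two counts agree because 0 and n are congruent modulo n, hence
    simultaneously coprime to n. *)
Lemma card_coprime_pos (n : nat) : 0 < n -> #|coprime_pos n| = totient n.
Proof.
case: n => // n _; rewrite totient_count_coprime -sum1_card.
have -> : \sum_(m in coprime_pos n.+1) 1
       = \sum_(0 <= i < n.+2) ((0 < i) && coprime i n.+1).
  by rewrite big_mkcond big_mkord; apply: eq_bigr => i _; rewrite inE; case: ifP.
rewrite big_nat_recl //= add0n big_nat_recr //= [RHS]big_nat_recl //= addnC.
congr (_ + _); first by rewrite /coprime gcdnn gcdn0.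
by apply: eq_bigr => i _; rewrite coprime_sym.
Qed.

Lemma card_prime_divisors (n : nat) :
  0 < n -> #|primes_upto n :\: coprime_pos n| = size (primes n).
Proof.
move=> n_gt0; rewrite cardE -(size_map val); apply/perm_size/uniq_perm.
- by rewrite map_inj_uniq ?enum_uniq //; apply: val_inj.
- exact: primes_uniq.
move=> p; rewrite mem_primes n_gt0 /=; apply/mapP/andP => [[i]|[p_pr p_dvd]].
  rewrite mem_enum !inE => /andP[ncop i_pr] ->; split=> //.
  by move: ncop; rewrite prime_gt0 //= prime_coprime // negbK.
have lt_pn : p < n.+1 by rewrite ltnS dvdn_leq.
exists (Ordinal lt_pn) => //.
by rewrite mem_enum !inE /= p_pr prime_gt0 //= prime_coprime // p_dvd.
Qed.

Lemma totient_np_formula (n : nat) : 0 < n ->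
  totient_np n + prime_pi n = totient n + prime_omega n.
Proof.
move=> n_gt0; rewrite /prime_omega -card_prime_divisors // -card_coprime_pos //.
have -> : totient_np n = #|coprime_pos n :\: primes_upto n|.
  by apply: eq_card => m; rewrite !inE andbA andbC.
have -> : prime_pi n = #|primes_upto n| by [].
rewrite -(cardsID (primes_upto n) (coprime_pos n)).
by rewrite -(cardsID (coprime_pos n) (primes_upto n)) setIC; lia.
Qed.

Lemma prime_pi_sum (n : nat) : prime_pi n = \sum_(0 <= i < n.+1) prime i.
Proof.
rewrite /prime_pi -sum1_card big_mkcond big_mkord.
by apply: eq_bigr => i _; rewrite inE; case: ifP.
Qed.

(** The minimality of [next_prime m] makes all terms strictly between [m] and
    [next_prime m] vanish, so only the last one contributes. *)
Lemma prime_pi_next (m : nat) : prime_pi (next_prime m) = (prime_pi m).+1.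
Proof.
rewrite !prime_pi_sum /next_prime.
case: ex_minnP => q /andP[lt_mq q_pr] q_min.
have le_mq : m.+1 <= q.+1 := ltnW lt_mq.
rewrite (big_cat_nat (leq0n m.+1) le_mq) -[RHS]addn1; congr (_ + _).
rewrite big_nat_recr //= q_pr.
rewrite big_nat_cond big1 // => i /andP[/andP[lt_mi lt_iq] _].
case: (boolP (prime i)) => // i_pr.
by have := q_min i; rewrite lt_mi i_pr leqNgt lt_iq => /(_ isT).
Qed.

Lemma prime_pi_kth_prime (k : nat) : prime_pi (kth_prime k) = k.
Proof.
elim: k => [|k IHk]; last by rewrite [kth_prime _]/= prime_pi_next IHk.
by rewrite prime_pi_sum !big_nat_recr //= big_geq.
Qed.

Lemma kth_prime_prime (k : nat) : 0 < k -> prime (kth_prime k).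
Proof.
by case: k => // k _; rewrite /= /next_prime; case: ex_minnP => q /andP[].
Qed.

Local Open Scope ring_scope.

Theorem proposition0 :
  (forall k : nat, (1 <= k)%N ->
     (totient_np (kth_prime k))%:Z = (kth_prime k)%:Z - k%:Z) /\
  (forall n : nat, (0 < n)%N ->
     (totient_np n)%:Z = (totient n)%:Z - (prime_pi n)%:Z + (prime_omega n)%:Z).
Proof.
split=> [k k_gt0|n n_gt0]; last by have := totient_np_formula n n_gt0; lia.
have p_pr := kth_prime_prime k k_gt0; have p_gt0 := prime_gt0 p_pr.
have := totient_np_formula _ p_gt0.
by rewrite totient_prime // prime_pi_kth_prime /prime_omega primes_prime //=; lia.
Qed.
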